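(* Any algorithm that solves the black hole search problem in dynamic cactus graphs $\mathcal{G}$ in which at most one edge is missing at any round requires at least $3$ agents. (That is, no algorithm using at most two agents solves black hole search on all such dynamic cactus graphs.)
   Context: Cactus graph: a connected undirected graph in which any two distinct simple cycles share at most one vertex (equivalently, every edge lies on at most one simple cycle). Dynamic cactus graph with at most $k$ dynamic edges at any round: a fixed cactus (the footprint, $G_0$) on a static vertex set $V$ with $|V|=n$, together with a sequence of graphs $G_0,G_1,G_2,\dots$, $G_r=(V,E_r)$, where $G_r$ is the footprint with at most $k$ edges missing, and each $G_r$ is connected ($1$-interval connectivity). At each round an adversary chooses which edges are missing; missing edges may reappear later. The degree $\deg(v)$ is the degree in $G_0$; $\Delta$ is the maximum degree. Nodes are anonymous. At each node $v$ the incident edges carry distinct port numbers $0,\dots,\deg(v)-1$ (in counter-clockwise order); the two port numbers of an edge are unrelated. Each node $v$ has a whiteboard of $O(\deg(v)(\log\deg(v)+k\log k))$ bits, readable and writable by visiting agents under fair mutual exclusion. Black hole: one node of the graph is a black hole; every agent entering it is destroyed without a trace. Agents: a set of $m\le n$ agents with distinct Ids in $[1,m]$, initially co-located at a node called home that is known not to be the black hole. All agents execute the same deterministic algorithm; each has $O(n\log\Delta)$ bits of memory. An agent at a node sees the degree, which incident edges are currently missing, the whiteboard, and the Ids of the other agents there, and can communicate with these agents. When moving along an edge it knows the port by which it leaves and the port by which it arrives. Any number of agents may use an edge simultaneously. Rounds: in every synchronous round each agent communicates (with co-located agents and via the whiteboard), computes a decision to stay or to leave through a port, and then moves (traversing a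 present edge takes one round). Black hole search problem (BHS): within finitely many rounds, at least one agent must survive, know the location of the black hole, and terminate, whatever the footprint, its port numbering, the location of the black hole, and the adversary's choice of missing edges. Here $k=1$. *)

(* Defs.v *)
From mathcomp Require Import all_boot.

Set Implicit Arguments.
Unset Strict Implicit.
Unset Printing Implicit Defensive.

(* The number of bits needed to write x.  Used as the logarithm in the O(.)
   memory bounds: it is within a constant factor of log x for x >= 2, and it
   is 1 instead of 0 at x = 1. *)
Definition lg (x : nat) : nat := up_log 2 x.+1.

(** ** Cactus graphs *)

Section Graph.

Variables (V : finType) (e : rel V).

Definition deg (v : V) : nat := #|[set w | e v w]|.

Definition max_deg : nat := \max_(v : V) deg v.

Definition edges : {set {set V}} :=
  [set [set d.1; d.2] | d : V * V & e d.1 d.2].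

Definition connected : Prop := forall u v : V, connect e u v.

Definition simple_cycle (c : seq V) : bool := [&& cycle e c, uniq c & 2 < size c].

(* A cycle is given by the list of its vertices, so that the same cycle has
   several lists (rotations, reversal); cycles are compared by their edges. *)
Definition cycle_edges (c : seq V) : {set {set V}} :=
  [set [set x; next c x] | x in c].

Definition cactus : Prop :=
  [/\ symmetric e, irreflexive e, connected &
      forall c1 c2 : seq V, simple_cycle c1 -> simple_cycle c2 ->
        cycle_edges c1 != cycle_edges c2 ->
        #|[set x in c1] :&: [set x in c2]| <= 1].

(** ** Port numberings *)

(* [port v w] is the port number at v of the edge vw; it is irrelevant when v
   and w are not adjacent. *)
Variable port : V -> V -> nat.

Definition neighbor (v : V) (p : nat) : option V :=
  [pick w | e v w && (port v w == p)].

(* The dart (u, v) is followed by the dart from v through the port after the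
   one of u, in the cyclic order of the ports of v. *)
Definition face_next (d : V * V) : V * V :=
  if e d.1 d.2 then
    (d.2, odflt d.1 (neighbor d.2 ((port d.2 d.1).+1 %% deg d.2)))
  else d.

(* The ports at v are a bijection from the incident edges to 0, ..., deg v - 1.
   They follow the counter-clockwise order around each node in some plane
   drawing: the cyclic orders of the ports form a rotation system, whose faces
   are the orbits of [face_next], and a rotation system of a connected graph
   (with at least one edge) is planar iff #V + #F = #E + 2. *)
Definition port_numbering : Prop :=
  [/\ forall v w, e v w -> port v w < deg v,
      forall v, {in [pred w | e v w] &, injective (port v)} &
      #|V| + fcard face_next [pred d : V * V | e d.1 d.2] = #|edges| + 2].

Definition follow (v : V) (route : seq nat) : option V :=
  foldl (fun u p => obind (fun u => neighbor u p) u) (Some v) route.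

End Graph.

(* [G r] is the graph of round r; [G 0] is the footprint. *)
Definition dynamic_cactus (k : nat) (V : finType) (G : nat -> rel V) : Prop :=
  cactus (G 0) /\
  forall r, [/\ symmetric (G r), subrel (G r) (G 0),
                #|edges (G 0) :\: edges (G r)| <= k & connected (G r)].

(** ** Algorithms *)

(* What an agent has to tell the agents at the same node: its Id, its memory,
   and the port through which it arrived in the previous round, or None if it
   did not move in that round. *)
Record agent_info := AgentInfo {
  info_id : nat;
  info_mem : bitseq;
  info_entry : option nat }.

Record observation := Observation {
  obs_self : agent_info;
  obs_others : seq agent_info;
  obs_deg : nat;
  obs_missing : seq nat; (* the ports of the missing incident edges *)
  obs_board : bitseq }.

(* Nodes are anonymous, so an agent that terminates states the location of the
   black hole as a route: the list of the ports to leave through, in the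
   footprint, to reach it from the node where the agent is. *)
Inductive decision :=
  | Stay
  | Leave (p : nat)
  | Terminate (route : seq nat).

Record action := Action {
  act_decision : decision;
  act_mem : bitseq;     (* new content of the memory *)
  act_board : bitseq }. (* new content of the whiteboard of the node *)

(* All agents run the same function; they differ by the Id in [obs_self]. *)
Definition algorithm := observation -> action.

(** ** Executions *)

Record agent (V : finType) := Agent {
  pos : V;
  mem : bitseq;
  entry : option nat;
  answer : option (seq nat) }. (* Some route once terminated *)

(* The agent with Id i + 1 is [agents i], or None once destroyed. *)
Record config (V : finType) (m : nat) := Config {
  agents : 'I_m -> option (agent V);
  board : V -> bitseq }.

Section Round.

Variables (m : nat) (alg : algorithm) (V : finType).
Variables (e : rel V) (port : V -> V -> nat) (bh : V).
Variable g : rel V. (* the graph of the current round *)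
Variable C : config V m.

Definition info (i : 'I_m) (a : agent V) : agent_info :=
  AgentInfo i.+1 (mem a) (entry a).

Definition others (i : 'I_m) (v : V) : seq agent_info :=
  pmap (fun j : 'I_m =>
          if agents C j is Some b then
            if (j != i) && (pos b == v) then Some (info j b) else None
          else None)
       (enum 'I_m).

Definition missing_ports (v : V) : seq nat :=
  [seq p <- iota 0 (deg e v) |
    if neighbor e port v p is Some w then ~~ g v w else false].

Definition act (i : 'I_m) (a : agent V) (w : bitseq) : action :=
  alg (Observation (info i a) (others i (pos a)) (deg e (pos a))
                   (missing_ports (pos a)) w).

(* Mutual exclusion: in each round the agents of a node access its whiteboard
   one after the other, by increasing Id. *)
Definition access (B : V -> bitseq) (i : 'I_m) : V -> bitseq :=
  if agents C i is Some a then
    if answer a is None then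
      fun v => if v == pos a then act_board (act i a (B v)) else B v
    else B
  else B.

Definition board_before (i : 'I_m) : V -> bitseq :=
  foldl access (board C) [seq j : 'I_m <- enum 'I_m | j < i].

(* Leaving through a missing edge, or through a port that does not exist,
   amounts to staying. *)
Definition move (v : V) (d : decision) : V * option nat :=
  if d is Leave p then
    if neighbor e port v p is Some w then
      if g v w then (w, Some (port w v)) else (v, None)
    else (v, None)
  else (v, None).

Definition next_agent (i : 'I_m) : option (agent V) :=
  if agents C i is Some a then
    if answer a is None then
      let r := act i a (board_before i (pos a)) in
      let: (v, p) := move (pos a) (act_decision r) in
      if v == bh then None
      else Some (Agent v (act_mem r) p
                       (if act_decision r is Terminate s then Some s else None))
    else Some a
  else None.

Definition next_config : config V m :=
  Config next_agent (foldl access (board C) (enum 'I_m)).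

End Round.

Definition init_config (m : nat) (V : finType) (home : V) : config V m :=
  Config (fun _ => Some (Agent home [::] None None)) (fun _ => [::]).

(* The configuration at the beginning of round r. *)
Fixpoint execution (m : nat) (alg : algorithm) (V : finType)
    (G : nat -> rel V) (port : V -> V -> nat) (home bh : V) (r : nat)
    : config V m :=
  if r is s.+1 then
    next_config alg (G 0) port bh (G s) (execution m alg G port home bh s)
  else init_config m home.

(** ** Black hole search *)

Definition bhs_instance (k m : nat) (V : finType) (G : nat -> rel V)
    (port : V -> V -> nat) (home bh : V) : Prop :=
  [/\ dynamic_cactus k G, port_numbering (G 0) port, m <= #|V| & home != bh].

Definition respects_memory (k m : nat) (alg : algorithm) : Prop :=
  exists c : nat,
    forall (V : finType) (G : nat -> rel V) port (home bh : V) (r : nat),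
      bhs_instance k m G port home bh ->
      let C := execution m alg G port home bh r in
      (forall i a, agents C i = Some a ->
         size (mem a) <= c * (#|V| * lg (max_deg (G 0)))) /\
      (forall v, size (board C v) <=
         c * (deg (G 0) v * (lg (deg (G 0) v) + k * lg k))).

Definition black_hole_found (m : nat) (V : finType) (e : rel V)
    (port : V -> V -> nat) (bh : V) (C : config V m) : Prop :=
  exists (i : 'I_m) (a : agent V) (route : seq nat),
    [/\ agents C i = Some a, answer a = Some route &
        follow e port (pos a) route = Some bh].

Definition solves_bhs (k m : nat) (alg : algorithm) : Prop :=
  respects_memory k m alg /\
  forall (V : finType) (G : nat -> rel V) port (home bh : V),
    bhs_instance k m G port home bh ->
    exists r, black_hole_found (G 0) port bh (execution m alg G port home bh r).

(* Main.v *)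
Require Import Defs.
From mathcomp Require Import all_boot zify.

Set Implicit Arguments.
Unset Strict Implicit.
Unset Printing Implicit Defensive.

(** The footprint is a ring with home 0 and nothing is missing until some agent
   first leaves home.  If nobody ever leaves, the same answers are given for
   three positions of the black hole.  At the first departure, orient the ring
   so that some agent a goes from 0 to the last node, and delete that edge
   forever.  If all agents take it, the black hole is there.  Otherwise the
   other agent b is at 0 or 1, and a and b are at the two ends of a line.  In
   the 3-ring with black hole 2, a is dead and b must answer without leaving
   {0, 1}.  In the 5-ring b cannot tell the difference when the black hole is 2,
   3 or 4, so it gives the same answer for all of them, which must be 4.  Hence
   a answers when the black hole is 3: to survive it never leaves node 4, so it
   gives the same answer when the black hole is 2, and nobody is right there. *)

(** * Rings, their cycles, their dynamics and their planar port numberings *)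

Section Ring.

Variable n : nat.
Local Notation V := 'I_n.+3.
Implicit Types (u v w : V) (s : bool).

Definition ring : rel V := fun v w => (w == ordS v) || (v == ordS w).

Definition line : rel V := fun v w => (w == v.+1 :> nat) || (v == w.+1 :> nat).

(** [s], read as a number, is the port towards the successor at every node: it is the orientation of
    the ring. *)
Definition ring_port s v w : nat := if w == ordS v then s else ~~ s.

Lemma val_ordS v : ordS v = (if v == n.+2 :> nat then 0 else v.+1) :> nat.
Proof.
rewrite /=; case: eqP => [->|ne]; first exact: modnn.
by rewrite modn_small //; have := ltn_ord v; lia.
Qed.

Lemma val_ord_pred v : ord_pred v = (if v == 0 :> nat then n.+2 else v.-1) :> nat.
Proof.
have := val_ordS (ord_pred v); rewrite ord_predK.
have := ltn_ord v; have := ltn_ord (ord_pred v).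
by move: (nat_of_ord (ord_pred v)) => m; do 2 case: eqP; lia.
Qed.

Lemma eq_ordS v w : (w == ordS v) = (w == (if v == n.+2 :> nat then 0 else v.+1) :> nat).
Proof. by rewrite -val_ordS. Qed.

Lemma ringC : symmetric ring.
Proof. by move=> v w; rewrite /ring orbC. Qed.

Lemma ringS v : ring v (ordS v).
Proof. by rewrite /ring eqxx. Qed.

Lemma ring_pred v : ring v (ord_pred v).
Proof. by rewrite /ring ord_predK eqxx orbT. Qed.

Lemma ringE v w : ring v w = (w == ordS v) || (w == ord_pred v).
Proof. by rewrite /ring [v == _]eq_sym (can2_eq (@ordSK _) (@ord_predK _)). Qed.

Lemma ordS_neq_pred v : ordS v != ord_pred v.
Proof.
apply/eqP => /(congr1 (@nat_of_ord _)); rewrite val_ordS val_ord_pred.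
by have := ltn_ord v; do 2 case: eqP; lia.
Qed.

Lemma ring_portS s v : ring_port s v (ordS v) = s.
Proof. by rewrite /ring_port eqxx. Qed.

Lemma ring_port_pred s v : ring_port s v (ord_pred v) = ~~ s.
Proof. by rewrite /ring_port eq_sym (negbTE (ordS_neq_pred v)). Qed.

Lemma deg_ring v : deg ring v = 2.
Proof.
rewrite /deg (_ : [set w | _] = [set ordS v; ord_pred v]) ?cards2 ?ordS_neq_pred //.
by apply/setP => w; rewrite !inE -ringE.
Qed.

Lemma line_ring : subrel line ring.
Proof.
move=> v w; rewrite /ring /line !eq_ordS; have := ltn_ord v; have := ltn_ord w.
by case: ifP => /eqP; case: ifP => /eqP; lia.
Qed.

Lemma line_connected : connected line.
Proof.
suff to0 v : connect line ord0 v.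
  have sym : connect_sym line by apply: sym_connect_sym => u v; rewrite /line orbC.
  by move=> u v; rewrite (connect_trans _ (to0 v)) // sym.
have [m vE] : exists m, m = v :> nat by exists v.
elim: m v vE => [|m IH] v vE; first by rewrite (_ : v = ord0) //; apply: val_inj.
have lt_m : m < n.+3 by have := ltn_ord v; lia.
apply: connect_trans (IH (Ordinal lt_m) erefl) (connect1 _).
by rewrite /line vE eqxx.
Qed.

Lemma ring_connected : connected ring.
Proof.
move=> u v; apply: connect_sub (line_connected u v) => x y xy.
exact/connect1/line_ring.
Qed.

(** At a node of a simple cycle the next and the previous node are distinct, so they are its only
    two neighbours in the ring. The cycle is thus closed under adjacency and, by connectivity,
    visits every node. *)
Lemma simple_cycle_edges (c : seq V) : simple_cycle ring c -> cycle_edges c = edges ring.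
Proof.
case/and3P => cyc uc sz.
have nexE x : x \in c -> ring x (next c x) by apply: next_cycle.
have preE x : x \in c -> ring x (prev c x).
  by rewrite ringC; apply: prev_cycle.
  have neq x : x \in c -> next c x != prev c x.
    move=> xc; have [i c' rotE] := rot_to xc.
    have uc' : uniq (x :: c') by rewrite -rotE rot_uniq.
    have sz' : 2 < size (x :: c') by rewrite -rotE size_rot.
    (* With [x] rotated to the front, the next node is the second entry and the previous one is the
       last; these are different entries of a list without repetition. *)
    rewrite -(next_rot i uc) -(prev_rot i uc) rotE prev_nth mem_head.
    case: c' uc' sz' {rotE} => [|y [|z c']] // /andP[xn yn] _.
    rewrite memNindex // nth_last /= eqxx; move: yn => /= /andP[yn _].
    by apply: contraNneq yn => ->; apply: mem_last.
  have nbr x y : x \in c -> ring x y -> (y == next c x) || (y == prev c x).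
    move=> xc; move: (nexE x xc) (preE x xc) (neq x xc).
    rewrite !ringE => /orP[]/eqP-> /orP[]/eqP->; rewrite ?eqxx //.
    by rewrite orbC.
  have cl : closed line (mem c).
    have cl1 x y : ring x y -> x \in c -> y \in c.
      by move=> xy xc; case/orP: (nbr _ _ xc xy) => /eqP->; rewrite ?mem_next ?mem_prev.
    move=> x y /line_ring xy; apply/idP/idP; apply: cl1 => //.
    by rewrite ringC.
  have all_c y : y \in c.
    case: c {cyc uc nexE preE neq nbr} sz cl => // x c _ cl.
    by rewrite -(closed_connect cl (line_connected x y)) mem_head.
  apply/setP => E; apply/imsetP/imsetP => [[x xc ->]|[[x y]]].
    by exists (x, next c x); rewrite ?inE //=; apply: nexE.
  rewrite inE /= => xy ->.
  case/orP: (nbr _ _ (all_c x) xy) => /eqP->; first by exists x.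
  by exists (prev c x); rewrite ?next_prev // setUC.
Qed.

Lemma ring_cactus : cactus ring.
Proof.
split; [exact: ringC | | exact: ring_connected |].
  move=> v; apply/negbTE; rewrite /ring orbb eq_ordS.
  by have := ltn_ord v; case: ifP => /eqP; lia.
by move=> c1 c2 /simple_cycle_edges-> /simple_cycle_edges->; rewrite eqxx.
Qed.

Lemma card_edges_ring : #|edges ring| = n.+3.
Proof.
have -> : edges ring = [set [set v; ordS v] | v : V].
  apply/setP => E; apply/imsetP/imsetP => [[[x y]]|[x _ ->]].
    rewrite inE /= => /orP[]/eqP-> ->; first by exists x.
    by exists y; rewrite ?inE // setUC.
  by exists (x, ordS x); rewrite ?inE //; apply: ringS.
rewrite card_imset ?card_ord // => v w /setP E.
have := E v; have := E (ordS v); rewrite !inE !eqxx orbT /=.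
case: (v =P w) => // _ /=; rewrite inj_eq; last exact: ordS_inj.
case: (v =P w) => // _; rewrite orbF => /esym/eqP wE /esym/eqP vE.
exfalso; move: (ordS_neq_pred w); rewrite -vE.
by rewrite -wE ordSK eqxx.
Qed.

(* [line] is the ring without the edge between home and the last node. *)
Definition round_graph (cut : bool) : rel V := if cut then line else ring.

(** Round 0 has to be the footprint, hence the guard [0 < r]. *)
Lemma ring_dynamic_cactus (cut : nat -> bool) :
  dynamic_cactus 1 (fun r => round_graph ((0 < r) && cut r)).
Proof.
split; first exact: ring_cactus.
move=> r; rewrite /round_graph; case: (_ && _); split.
- by move=> v w; rewrite /line orbC.
- exact: line_ring.
- rewrite -[X in _ <= X](cards1 [set (ord0 : V); ord_max]).
  apply/subset_leq_card/subsetP => E.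
  rewrite !inE => /andP[nl /imsetP[[x y]]]; rewrite inE /= => xy Ee.
  apply/eqP; move: nl; rewrite Ee.
  have notin (v w : V) : [set v; w] \notin edges line -> ordS v = w ->
     [set v; w] = [set ord0; ord_max].
    move=> nl vw; have vm : v = ord_max.
      apply: contraNeq nl => nv; apply/imsetP; exists (v, w); rewrite ?inE //.
      by rewrite /line -vw val_ordS ifN ?eqxx.
    by rewrite -vw vm setUC; congr [set _; _]; apply: ord_inj; rewrite val_ordS eqxx.
  case/orP: (xy : ring x y) => /eqP e nl; first exact: notin.
  by rewrite setUC; apply: notin; rewrite // setUC.
- exact: line_connected.
- exact: ringC.
- by [].
- by rewrite setDv cards0.
- exact: ring_connected.
Qed.

Lemma neighbor_ring s v p :
  neighbor ring (ring_port s) v p =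
    if p == s then Some (ordS v) else if p == ~~ s then Some (ord_pred v) else None.
Proof.
rewrite /neighbor; case: pickP => [w|none].
  rewrite ringE => /andP[/orP[]/eqP->].
    by rewrite ring_portS eq_sym => ->.
  rewrite ring_port_pred eq_sym => /eqP->; case: s => //=.
have := none (ordS v); have := none (ord_pred v).
rewrite !ringE !eqxx orbT ring_portS ring_port_pred /=.
by rewrite ![_ == p]eq_sym => -> ->.
Qed.

Lemma iter_ordS v : iter v (@ordS _) ord0 = v.
Proof.
suff it m : m < n.+3 -> iter m (@ordS _) (ord0 : V) = m :> nat by exact/ord_inj/it.
elim: m => // m IH ltm; rewrite iterS val_ordS IH; last exact: ltnW.
by rewrite -eqSS ltn_eqF.
Qed.

Lemma iter_ord_pred v : iter v (@ord_pred _) v = ord0.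
Proof.
rewrite -[X in iter _ _ X]iter_ordS.
by elim: (nat_of_ord v) => // m IH; rewrite iterSr iterS ordSK.
Qed.

(** A ring has as many edges as nodes, so planarity asks for exactly two faces: the forward darts
    form one orbit of [face_next], the backward darts the other. *)
Lemma ring_port_numbering s : port_numbering ring (ring_port s).
Proof.
pose f := face_next ring (ring_port s).
have fS v : f (v, ordS v) = (ordS v, ordS (ordS v)).
  rewrite /f /face_next ringS /= neighbor_ring deg_ring.
  by rewrite -[X in ring_port _ _ X](ordSK v) ring_port_pred; case: s {f}.
have fP v : f (v, ord_pred v) = (ord_pred v, ord_pred (ord_pred v)).
  rewrite /f /face_next ring_pred /= neighbor_ring deg_ring.
  by rewrite -[X in ring_port _ _ X](ord_predK v) ring_portS; case: s {f fS}.
have f_inj : injective f.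
  (* [h] steps back along a face. *)
  pose h d := if ring d.1 d.2 then
    (if d.2 == ordS d.1 then ord_pred d.1 else ordS d.1, d.1) else d : V * V.
  apply: (can_inj (g := h)) => -[v w].
  have [vw|/negbTE vw] := boolP (ring v w); last by rewrite /h /f /face_next vw /= vw.
  move: vw; rewrite ringE => /orP[]/eqP->.
    by rewrite fS /h ringS eqxx ordSK.
  by rewrite fP /h ring_pred eq_sym (negbTE (ordS_neq_pred _)) ord_predK.
have symf := fconnect_sym f_inj.
split.
- by move=> v w _; rewrite deg_ring /ring_port; case: ifP; case: s {f fS fP f_inj symf}.
- move=> v w1 w2; rewrite !inE !ringE => /orP[]/eqP-> /orP[]/eqP->;
  by rewrite ?ring_portS ?ring_port_pred //; case: s {f fS fP f_inj symf}.
rewrite card_ord card_edges_ring; congr (_ + _); rewrite -/f.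
pose dS : V * V := (ord0, ordS ord0); pose dP : V * V := (ord0, ord_pred ord0).
have itS v k : iter k f (v, ordS v) = (iter k (@ordS _) v, ordS (iter k (@ordS _) v)).
  by elim: k => // k; rewrite !iterS => ->.
have itP v k : iter k f (v, ord_pred v) =
    (iter k (@ord_pred _) v, ord_pred (iter k (@ord_pred _) v)).
  by elim: k => // k; rewrite !iterS => ->.
(* This is the form in which [n_comp_closure2] counts the orbits meeting a pair; [dS] and [dP]
   represent the two faces. *)
rewrite (_ : 2 = (~~ fconnect f dS dP).+1); last first.
  have [/iter_findex|//] := boolP (fconnect f dS dP).
  rewrite itS; move: (iter _ _ _) => x E; have x0 : x = ord0 := congr1 fst E.
  by have /eqP : ordS x = ord_pred ord0 := congr1 snd E; rewrite x0 (negbTE (ordS_neq_pred _)).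
rewrite -(n_comp_closure2 symf); apply: eq_n_comp_r => -[v w].
rewrite inE /=; apply/idP/idP => [|/existsP[d]].
  rewrite ringE => /orP[]/eqP->; apply/existsP.
    exists dS; rewrite !inE eqxx /= andbT symf.
    by have := fconnect_iter f v dS; rewrite itS iter_ordS.
  exists dP; rewrite !inE eqxx orbT andbT.
  by have := fconnect_iter f v (v, ord_pred v); rewrite itP iter_ord_pred.
rewrite !inE => /andP[cn dE]; move: cn; rewrite symf.
case/orP: dE => /eqP-> /iter_findex; rewrite ?itS ?itP; move: (iter _ _ _) => x [<- <-].
  exact: ringS.
exact: ring_pred.
Qed.

End Ring.

(** * The part of a configuration located at one node *)

Section Seen.

Variables (m : nat) (V : finType).
Implicit Types (C : config V m) (j : 'I_m) (v : V).

(** The position is left out so that states in rings of different sizes can be compared. A destroyed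
    agent and one that is elsewhere both give [None]. *)
Definition seen C j v : option (bitseq * option nat * option (seq nat)) :=
  if agents C j is Some a then
    if pos a == v then Some (Defs.mem a, entry a, answer a) else None
  else None.

Lemma seen_pos C j a : agents C j = Some a ->
  seen C j (pos a) = Some (Defs.mem a, entry a, answer a).
Proof. by rewrite /seen => ->; rewrite eqxx. Qed.

Lemma seen_Some C j v st : seen C j v = Some st ->
  agents C j = Some (Agent v st.1.1 st.1.2 st.2).
Proof.
by rewrite /seen; case: (agents C j) => // -[u mm en an] /=; case: eqP => // -> [<-].
Qed.

Lemma others_seen C i v :
  others C i v = pmap (fun j => if j == i then None else
    omap (fun st => AgentInfo j.+1 st.1.1 st.1.2) (seen C j v)) (enum 'I_m).
Proof.
apply: eq_pmap => j; rewrite /seen; case: (agents C j) => [b|]; last by case: ifP.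
by case: eqP => //= _; case: eqP.
Qed.

End Seen.

(** * Actions and whiteboard updates depend on local data only *)

Section Locality.

Variables (m : nat) (alg : algorithm) (V V' : finType).
Variables (e g : rel V) (port : V -> V -> nat) (C : config V m) (v : V).
Variables (e' g' : rel V') (port' : V' -> V' -> nat) (C' : config V' m) (v' : V').

Hypothesis eq_seen : forall j, seen C j v = seen C' j v'.
Hypothesis eq_board : board C v = board C' v'.
Hypothesis eq_deg : deg e v = deg e' v'.
Hypothesis eq_missing : missing_ports e port g v = missing_ports e' port' g' v'.

(** Other agents enter an observation only through [seen], and answers do not enter it, so [an] and
    [an'] may differ. *)
Lemma act_local i mm en an an' w :
  act alg e port g C i (Agent v mm en an) w =
  act alg e' port' g' C' i (Agent v' mm en an') w.
Proof.
rewrite /act eq_deg eq_missing !others_seen.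
by under eq_pmap => j do rewrite eq_seen.
Qed.

Lemma access_local B B' i : B v = B' v' ->
  access alg e port g C B i v = access alg e' port' g' C' B' i v'.
Proof.
move=> eqB; have := eq_seen i; rewrite /access /seen.
case: (agents C i) => [[u mm en an]|]; case: (agents C' i) => [[u' mm' en' an']|] //=.
- rewrite [u == v]eq_sym [u' == v']eq_sym.
  case: (v =P u) => [<-|ne]; case: (v' =P u') => [<-|ne'] //.
    case=> <- <- <-; case: an => //=; rewrite !eqxx /= eqB.
    by congr act_board; apply: act_local.
  by move=> _; case: an => [?|]; case: an' => [?|] //=; case: eqP => //; case: eqP.
- by case: eqP => // ne _; case: an => //=; case: eqP => // /esym.
- by case: eqP => // ne _; case: an' => //=; case: eqP => // /esym.
Qed.

Lemma foldl_access_local s :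
  foldl (access alg e port g C) (board C) s v =
  foldl (access alg e' port' g' C') (board C') s v'.
Proof.
elim/last_ind: s => [|s i IH] //=.
by rewrite -!cats1 !foldl_cat /=; apply: access_local.
Qed.

End Locality.

(** * Moves and missing ports in the ring and in the line *)

Section RingMoves.

Variables (n : nat) (s : bool).
Implicit Types v : 'I_n.+3.

Lemma line_ordS v : line v (ordS v) = (v != n.+2 :> nat).
Proof. by rewrite /line !val_ordS; case: ifP => /eqP; lia. Qed.

Lemma line_ord_pred v : line v (ord_pred v) = (v != 0 :> nat).
Proof.
by rewrite /line !val_ord_pred; case: ifP => /eqP; lia.
Qed.

Lemma round_graph_ordS cut v : round_graph cut v (ordS v) = ~~ (cut && (v == n.+2 :> nat)).
Proof. by rewrite /round_graph; case: cut; rewrite ?line_ordS ?ringS. Qed.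

Lemma round_graph_pred cut v : round_graph cut v (ord_pred v) = ~~ (cut && (v == 0 :> nat)).
Proof. by rewrite /round_graph; case: cut; rewrite ?line_ord_pred ?ring_pred. Qed.

Lemma move_ring cut v d :
  move (@ring n) (ring_port s) (round_graph cut) v d =
  if d is Leave p then
    if (p == s) && ~~ (cut && (v == n.+2 :> nat)) then (ordS v, Some (~~ s : nat))
    else if (p == ~~ s) && ~~ (cut && (v == 0 :> nat)) then (ord_pred v, Some (s : nat))
    else (v, None)
  else (v, None).
Proof.
case: d => // p; rewrite /move neighbor_ring.
case: eqP => [->|_] /=.
  rewrite round_graph_ordS -[X in ring_port s _ X](ordSK v) ring_port_pred.
  by case: ifP => // _; case: (s).
case: eqP => [_|_] //=.
by rewrite round_graph_pred -[X in ring_port s _ X](ord_predK v) ring_portS.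
Qed.

Lemma missing_ring cut v :
  missing_ports (@ring n) (ring_port s) (round_graph cut) v =
  [seq p <- [:: 0; 1] | cut && (if p == s :> nat then v == n.+2 :> nat else v == 0 :> nat)].
Proof.
rewrite /missing_ports deg_ring; apply: eq_in_filter => p; rewrite !inE neighbor_ring => p01.
case: eqP => [_|ps] /=; first by rewrite round_graph_ordS negbK.
rewrite ifT ?round_graph_pred ?negbK //.
by case: (s) p01 ps => /orP[]/eqP->.
Qed.

(** Without the edge between the two ends, node numbers are coordinates on a line: no move wraps
    around. *)
Lemma move_line v d : let w := (move (@ring n) (ring_port s) (round_graph true) v d).1 in
  w <= v.+1 /\ v <= w.+1.
Proof.
rewrite move_ring; case: d => [|p|?] /=; try lia.
case: ifP => [/andP[_ ne]|_] /=; first by move: (val_ordS v); rewrite /= (negbTE ne) => ->; lia.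
case: ifP => [/andP[_ ne]|_] /=; last lia.
by move: (val_ord_pred v); rewrite /= (negbTE ne) => ->; lia.
Qed.

End RingMoves.

(** * Indistinguishable executions *)

Section Mirror.

Variables (m : nat) (alg : algorithm).
Implicit Types S : pred nat.

Definition ring_step n s cut bh (C : config 'I_n.+3 m) : config 'I_n.+3 m :=
  next_config alg (@ring n) (ring_port s) bh (@round_graph n cut) C.

(* S selects the nodes, compared by number, on which two executions in rings of
   possibly different sizes are indistinguishable. *)
Definition same n n' (S : pred nat) (C : config 'I_n.+3 m) (C' : config 'I_n'.+3 m) :=
  forall (v : 'I_n.+3) (v' : 'I_n'.+3), v = v' :> nat -> S v ->
    (forall j, seen C j v = seen C' j v') /\ board C v = board C' v'.

Definition no_arrival n (S : pred nat) (C C1 : config 'I_n.+3 m) :=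
  forall j (v : 'I_n.+3), S v ->
    (forall u : 'I_n.+3, S u -> seen C j u = None) -> seen C1 j v = None.

(** Moves leaving [S] in both rings may end at unrelated nodes; only destinations inside [S] must
    agree. *)
Definition compatible n n' s s' cut cut' (S : pred nat) :=
  forall (v : 'I_n.+3) (v' : 'I_n'.+3), v = v' :> nat -> S v ->
    missing_ports (@ring n) (ring_port s) (round_graph cut) v =
    missing_ports (@ring n') (ring_port s') (round_graph cut') v' /\
    forall d, let w := move (@ring n) (ring_port s) (round_graph cut) v d in
      let w' := move (@ring n') (ring_port s') (round_graph cut') v' d in
      S w.1 || S w'.1 -> w.1 = w'.1 :> nat /\ w.2 = w'.2.

Lemma ring_step_None n s cut bh (C : config 'I_n.+3 m) j :
  agents C j = None -> agents (ring_step s cut bh C) j = None.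
Proof. by rewrite /= /next_agent => ->. Qed.

Lemma ring_step_answered n s cut bh (C : config 'I_n.+3 m) j a :
  agents C j = Some a -> answer a <> None -> agents (ring_step s cut bh C) j = Some a.
Proof. by rewrite /= /next_agent => ->; case: (answer a). Qed.

Lemma ring_step_bh n s cut bh (C : config 'I_n.+3 m) j a :
  agents (ring_step s cut bh C) j = Some a -> agents C j = Some a \/ pos a != bh.
Proof.
rewrite /= /next_agent; case Cj: (agents C j) => [b|] //.
case: (answer b) => [_|]; first by left.
by case: (move _ _ _ (pos b) _) => w q; case: ifP => // /negbT wbh [<-]; right.
Qed.

Lemma same_local n n' s s' cut cut' S C C' :
  same S C C' -> compatible n n' s s' cut cut' S ->
  forall (u : 'I_n.+3) (u' : 'I_n'.+3), u = u' :> nat -> S u ->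
    (forall i mm en an an' w,
      act alg (@ring n) (ring_port s) (round_graph cut) C i (Agent u mm en an) w =
      act alg (@ring n') (ring_port s') (round_graph cut') C' i (Agent u' mm en an') w) /\
    (forall l,
      foldl (access alg (@ring n) (ring_port s) (round_graph cut) C) (board C) l u =
      foldl (access alg (@ring n') (ring_port s') (round_graph cut') C') (board C') l u').
Proof.
move=> eqC compat u u' uu' Su; have [sn bd] := eqC u u' uu' Su.
have [mi _] := compat u u' uu' Su; split=> *.
  by apply: act_local; rewrite // !deg_ring.
by apply: foldl_access_local; rewrite // !deg_ring.
Qed.

(** An agent in [S] observes the same in both executions, so it acts alike and either lands on the
    same node of [S] or leaves [S] in both. Any other agent is kept out by [no_arrival]. *)
Lemma same_step n n' s s' cut cut' (bh : 'I_n.+3) (bh' : 'I_n'.+3) (S : pred nat) C C' :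
  (forall c, S c -> c < n.+3 /\ c < n'.+3) -> ~~ S bh -> ~~ S bh' ->
  compatible n n' s s' cut cut' S ->
  no_arrival S C (ring_step s cut bh C) -> no_arrival S C' (ring_step s' cut' bh' C') ->
  same S C C' -> same S (ring_step s cut bh C) (ring_step s' cut' bh' C').
Proof.
move=> bound Sbh Sbh' compat noC noC' eqC v v' vv' Sv.
have Sv' : S v' by rewrite -vv'.
have loc := same_local eqC compat.
split; last by have [_ eqb] := loc v v' vv' Sv; apply: eqb.
move=> j.
have empty' : (forall u : 'I_n.+3, S u -> seen C j u = None) ->
    forall u : 'I_n'.+3, S u -> seen C' j u = None.
  move=> none u Su; have [lt_u _] := bound _ Su.
  by have [<- _] := eqC (Ordinal lt_u) u erefl Su; apply: none.
case Ca: (agents C j) => [[u mm en an]|]; last first.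
  have none (u : 'I_n.+3) : S u -> seen C j u = None by rewrite /seen Ca.
  by rewrite noC // noC' //; apply: empty'.
have [Su|nSu] := boolP (S u); last first.
  have none (w : 'I_n.+3) : S w -> seen C j w = None.
    by move=> Sw; rewrite /seen Ca /=; case: eqP Sw nSu => // -> ->.
  by rewrite noC // noC' //; apply: empty'.
have [_ lt_u'] := bound _ Su; pose u' := Ordinal lt_u'.
have [sn _] := eqC u u' erefl Su; have := seen_pos Ca; rewrite /= sn => /seen_Some /= Ca'.
have [eq_act eq_bd] := loc u u' erefl Su.
have [_ mv] := compat u u' erefl Su.
rewrite /seen /= /next_agent Ca Ca' /=; case: an Ca Ca' => [an|] Ca Ca' /=.
  by rewrite -!val_eqE /= vv'.
rewrite /board_before eq_bd -(eq_act j mm en None None).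
set r := act _ _ _ _ _ _ _ _.
move: (mv (act_decision r)) => /=.
case: (move _ _ _ u _) => w q; case: (move _ _ _ u' _) => w' q' /= ww'.
have [Sw|nSw] := boolP (S w || S w').
  have [eqw <-] := ww' Sw.
  have [Sw1 Sw1'] : S w /\ S w' by move: Sw; rewrite eqw orbb.
  have /negbTE-> : w != bh by apply: contraNneq Sbh => <-.
  have /negbTE-> : w' != bh' by apply: contraNneq Sbh' => <-.
  by rewrite /= -!val_eqE /= eqw vv'.
(* Both destinations are outside [S], so the agent is not seen at [v] or [v'], whether destroyed or
   not. *)
have [nw nw'] : w != v /\ w' != v'.
  by split; apply: contraNneq nSw => ->; rewrite ?Sv ?Sv' ?orbT.
by case: (w == bh); case: (w' == bh'); rewrite //= ?(negbTE nw) ?(negbTE nw').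
Qed.

Lemma compatible_refl n s cut S : compatible n n s s cut cut S.
Proof. by move=> v v' /ord_inj-> _; split=> // d _. Qed.

(** Opposite orientations are allowed: both ports lead away from home, and no edge is missing. *)
Lemma compatible_home n n' s s' : compatible n n' s s' false false (pred1 0).
Proof.
move=> v v' vv' /eqP v0; rewrite !missing_ring; split=> // d.
have [Sv Sv' Pv Pv'] : [/\ ordS v = 1 :> nat, ordS v' = 1 :> nat,
    ord_pred v = n.+2 :> nat & ord_pred v' = n'.+2 :> nat].
  by rewrite !val_ordS !val_ord_pred -vv' v0.
rewrite /= in Sv Sv' Pv Pv'; rewrite !move_ring.
by case: d => [|[|[|p]]|r]; case: s; case: s'; rewrite /= ?Sv ?Sv' ?Pv ?Pv' -?vv' ?v0.
Qed.

(** The size of the ring shows only in where the predecessor of 0 is, and that node is outside {0,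
    1} in both rings. *)
Lemma compatible_home_nbr n n' s cut : compatible n n' s s cut cut (fun c => c < 2).
Proof.
move=> v v' vv' v2; rewrite !missing_ring -vv'.
have [/negbTE vn /negbTE vn'] : v != n.+2 :> nat /\ v != n'.+2 :> nat by lia.
rewrite vn vn'; split=> // d.
have [Sv Sv'] : ordS v = v.+1 :> nat /\ ordS v' = v.+1 :> nat.
  by rewrite !val_ordS -vv' vn vn'.
have [Pv Pv'] : ord_pred v = (if v == 0 :> nat then n.+2 else v.-1) :> nat /\
    ord_pred v' = (if v == 0 :> nat then n'.+2 else v.-1) :> nat.
  by rewrite !val_ord_pred -vv'.
rewrite /= in Sv Sv' Pv Pv'; rewrite !move_ring -vv' vn vn' andbF; case: d => [|p|r] //.
do ?case: ifP => _; rewrite /= ?Sv ?Sv' ?Pv ?Pv' -?vv' //.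
by case: eqP.
Qed.

Lemma no_arrival_in n s cut bh S (C : config 'I_n.+3 m) :
  (forall j a, agents C j = Some a -> S (pos a)) -> no_arrival S C (ring_step s cut bh C).
Proof.
move=> inS j v Sv none; case Cj: (agents C j) => [a|]; last first.
  by rewrite /seen ring_step_None.
by have := none _ (inS _ _ Cj); rewrite (seen_pos Cj).
Qed.

Lemma board_unseen n s cut bh (C : config 'I_n.+3 m) v :
  (forall j, seen C j v = None) -> board (ring_step s cut bh C) v = board C v.
Proof.
move=> none; rewrite /ring_step /=; elim/last_ind: (enum _) => // l i IH.
rewrite -cats1 foldl_cat /= {1}/access; have := none i; rewrite /seen.
case: (agents C i) => [[u mm en [an|]]|] //=.
by rewrite [v == u]eq_sym; case: ifP.
Qed.

End Mirror.

(** * Executions in rings and the answers given there *)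

Section Worlds.

Variables (m : nat) (alg : algorithm).
Implicit Types (s : bool) (cut : nat -> bool) (j : 'I_m).

Definition schedule n cut r : rel 'I_n.+3 := round_graph ((0 < r) && cut r).

Definition world n s cut (bh : 'I_n.+3) r : config 'I_n.+3 m :=
  execution m alg (@schedule n cut) (ring_port s) ord0 bh r.

Lemma worldS n s cut (bh : 'I_n.+3) r :
  world s cut bh r.+1 = ring_step alg s ((0 < r) && cut r) bh (world s cut bh r).
Proof. by []. Qed.

Lemma world_bh n s cut (bh : 'I_n.+3) r j a :
  bh != ord0 -> agents (world s cut bh r) j = Some a -> pos a != bh.
Proof.
move=> bh0; elim: r a => [|r IH] a; first by case=> <-; rewrite eq_sym.
by rewrite worldS => /ring_step_bh[/IH|].
Qed.

Lemma world_dead n s cut (bh : 'I_n.+3) r r' j : r <= r' ->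
  agents (world s cut bh r) j = None -> agents (world s cut bh r') j = None.
Proof.
move=> /subnK<-; elim: (r' - r) => // d IH /IH dead.
by rewrite addSn worldS ring_step_None.
Qed.

Lemma world_answered n s cut (bh : 'I_n.+3) r r' j a : r <= r' ->
  answer a <> None ->
  agents (world s cut bh r) j = Some a -> agents (world s cut bh r') j = Some a.
Proof.
move=> /subnK<- ans; elim: (r' - r) => // d IH /IH al.
by rewrite addSn worldS (ring_step_answered _ _ _ _ al).
Qed.

Definition answers n s cut (bh : 'I_n.+3) j r :=
  exists (a : agent 'I_n.+3) route, [/\ agents (world s cut bh r) j = Some a,
    answer a = Some route & follow (@ring n) (ring_port s) (pos a) route = Some bh].

(** Destruction is permanent, which settles the earlier rounds; a terminated agent no longer
    changes, which settles the later ones. *)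
Lemma answers_alive n s cut (bh : 'I_n.+3) j r r' : answers s cut bh j r ->
  exists a, agents (world s cut bh r') j = Some a.
Proof.
case=> a [route [al an _]]; have [le|/ltnW le] := leqP r r'.
  by exists a; apply: world_answered le _ al; rewrite an.
case al': (agents (world s cut bh r') j) => [a'|]; first by exists a'.
by move: al; rewrite (world_dead le al').
Qed.

(** At a late enough round both executions show the same terminated agent, and its route from its
    node has a single end. *)
Lemma answers_uniq n s cut (bh bh' : 'I_n.+3) j r r' r0 :
  (forall R, r0 <= R -> agents (world s cut bh R) j = agents (world s cut bh' R) j) ->
  answers s cut bh j r -> answers s cut bh' j r' -> bh = bh'.
Proof.
move=> eqR [a [t [al an fo]]] [a' [t' [al' an' fo']]].
pose R := maxn r0 (maxn r r').
have := eqR R (leq_maxl _ _).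
rewrite (world_answered _ _ al) ?an // ?(world_answered _ _ al') ?an' //;
  try by rewrite /R; lia.
case=> aa'; move: an an' fo fo'; rewrite aa' => -> [->] ->.
by case.
Qed.

Hypothesis solved : solves_bhs 1 m alg.
Hypothesis few : m < 3.

Lemma some_answer n s cut (bh : 'I_n.+3) : bh != ord0 -> exists j r, answers s cut bh j r.
Proof.
move=> bh0; case: solved => _ /(_ _ (@schedule n cut) (ring_port s) ord0 bh).
case.
  split; rewrite 1?eq_sym //; last by rewrite card_ord; lia.
    exact: ring_dynamic_cactus.
  exact: ring_port_numbering.
by move=> r [j [a [t [al an fo]]]]; exists j, r, a, t.
Qed.

(** * The time during which all agents are at home *)

Definition at_home n (C : config 'I_n.+3 m) :=
  [forall j, if agents C j is Some a then pos a == ord0 else false].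

Lemma at_homeP n (C : config 'I_n.+3 m) j : at_home C ->
  exists mm en an, agents C j = Some (Agent ord0 mm en an).
Proof.
move/forallP/(_ j); case: (agents C j) => [[u mm en an] /= /eqP->|//].
by exists mm, en, an.
Qed.

Lemma at_home_no_arrival n s (cut : bool) bh (S : pred nat) (C : config 'I_n.+3 m) :
  S 0 -> at_home C -> no_arrival S C (ring_step alg s cut bh C).
Proof.
move=> S0 homeC; apply: no_arrival_in => j a.
by have [mm [en [an ->]]] := at_homeP j homeC; case=> <-.
Qed.

Lemma at_home_same n n' (C : config 'I_n.+3 m) (C' : config 'I_n'.+3 m) :
  same (pred1 0) C C' -> at_home C -> at_home C'.
Proof.
move=> eqC homeC; apply/forallP => j; have [mm [en [an Cj]]] := at_homeP j homeC.
have [sn _] := eqC ord0 ord0 erefl (eqxx _).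
by have := seen_pos Cj; rewrite /= sn => /seen_Some->.
Qed.

(* As long as no agent leaves home, this one execution determines what happens
   in all rings, with all orientations and black holes. *)
Definition waiting r := world true pred0 (ord_max : 'I_3) r.

Lemma waiting_same R n s cut (bh : 'I_n.+3) :
  (forall r, r <= R -> at_home (waiting r)) -> bh != ord0 ->
  (forall r, r < R -> (0 < r) && cut r = false) ->
  [/\ same (pred1 0) (waiting R) (world s cut bh R), at_home (world s cut bh R) &
      forall v, v != ord0 -> board (world s cut bh R) v = [::]].
Proof.
move=> + bh0; elim: R => [|R IH] home cut0.
  split=> //; last by apply/forallP => j /=.
  move=> v v' vv' /eqP v0; have -> : v = ord0 by apply: ord_inj.
  have -> : v' = ord0 by apply: ord_inj; rewrite -vv'.
  by split.
have homeR := home R (leqnSn R).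
have [|r /ltnW|eqR homeW bdR] := IH; first by move=> r /leqW; apply: home.
  exact: cut0.
have eqS : same (pred1 0) (waiting R.+1) (world s cut bh R.+1).
  rewrite /waiting !worldS cut0 // andbF; apply: same_step => //.
  - by move=> c /eqP->.
  - exact: compatible_home.
  - exact: at_home_no_arrival.
  - exact: at_home_no_arrival.
split=> //; first exact: at_home_same eqS (home _ _).
move=> v v0; rewrite worldS board_unseen ?bdR // => j.
have [mm [en [an Wj]]] := at_homeP j homeW.
by rewrite /seen Wj /= eq_sym (negbTE v0).
Qed.

(** Away from home both executions have no agents and empty whiteboards, so any [S] will do. *)
Lemma waiting_same2 R n n' s s' cut cut' (bh : 'I_n.+3) (bh' : 'I_n'.+3) S :
  (forall r, r <= R -> at_home (waiting r)) -> bh != ord0 -> bh' != ord0 ->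
  (forall r, r < R -> (0 < r) && cut r = false) ->
  (forall r, r < R -> (0 < r) && cut' r = false) ->
  same S (world s cut bh R) (world s' cut' bh' R).
Proof.
move=> home b0 b0' c0 c0'.
have [eqC homeC bdC] := waiting_same s home b0 c0.
have [eqC' homeC' bdC'] := waiting_same s' home b0' c0'.
move=> v v' vv' _; have [v0|v0] := eqVneq v ord0.
  have v0' : v' = ord0 by apply: ord_inj; rewrite -vv' v0.
  rewrite v0 v0'; have [sn <-] := eqC ord0 ord0 erefl (eqxx _).
  have [sn' <-] := eqC' ord0 ord0 erefl (eqxx _).
  by split=> // j; rewrite -sn -sn'.
have v0' : v' != ord0 by apply: contraNneq v0 => e; apply/eqP/ord_inj; rewrite vv' e.
rewrite bdC ?bdC' //; split=> // j.
have [mm [en [an Wj]]] := at_homeP j homeC.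
have [mm' [en' [an' Wj']]] := at_homeP j homeC'.
by rewrite /seen Wj Wj' /= ![ord0 == _]eq_sym (negbTE v0) (negbTE v0').
Qed.

Lemma same_agents n S (C C' : config 'I_n.+3 m) j a :
  same S C C' -> agents C j = Some a -> S (pos a) -> agents C' j = Some a.
Proof.
move=> eqC Cj Sa; have [sn _] := eqC _ _ erefl Sa.
by move: (seen_pos Cj); rewrite sn => /seen_Some->; case: a {Cj Sa sn}.
Qed.

(** The states of the agents do not depend on the black hole, so the black holes 1, 2 and 3 of the
    5-ring need three different agents to answer correctly. *)
Lemma not_waiting_forever : ~ (forall r, at_home (waiting r)).
Proof.
move=> home; pose bh (i : 'I_3) : 'I_5 := lift ord0 (inord i).
have bh0 i : bh i != ord0 by rewrite eq_sym neq_lift.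
have [f ans] := fin_all_exists (fun i => some_answer true pred0 (bh0 i)).
suff inj : injective f by have := leq_card f inj; rewrite !card_ord leqNgt few.
move=> i i' eqf; have [r a] := ans i; have [r' a'] := ans i'; rewrite -eqf in a'.
suff /lift_inj /(congr1 val) : bh i = bh i'.
  rewrite /= !inordK; first exact: ord_inj.
    by apply: ltn_trans (ltn_ord _) _.
  by apply: ltn_trans (ltn_ord _) _.
apply: (answers_uniq (r0 := 0)) a a' => R _.
have homeR r'' : r'' <= R -> at_home (waiting r'') by [].
have c0 r'' : r'' < R -> (0 < r'') && pred0 r'' = false by rewrite andbF.
have [_ homeW _] := waiting_same true homeR (bh0 i) c0.
have [mm [en [an Wj]]] := at_homeP (f i) homeW.
rewrite Wj; apply/esym; apply: same_agents Wj _; last exact: (erefl : predT _ = true).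
exact: waiting_same2.
Qed.

(** The conclusion is conditional because [a] is destroyed at once if the last node is the black
    hole. *)
Lemma first_leaver r0 :
  (forall r, r <= r0 -> at_home (waiting r)) -> ~~ at_home (waiting r0.+1) ->
  exists (a : 'I_m) s, forall n (bh : 'I_n.+3) A, bh != ord0 ->
    agents (world s (fun r => r0 < r) bh r0.+1) a = Some A -> pos A = ord_max.
Proof.
move=> home; rewrite negb_forall => /existsP[a leaves].
have [mm [en [an Ca]]] := at_homeP a (home r0 (leqnn _)).
rewrite /waiting worldS andbF /= /next_agent Ca /= in leaves.
case: an Ca leaves => [an|] Ca //.
set d := act_decision _ => leaves.
(* Leaving through any other port amounts to staying. *)
have [p p2 dE] : exists2 p, p < 2 & d = Leave p.
  move: leaves; rewrite (@move_ring 0 true false); case: d => [|[|[|p]]|r] //= _.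
    by exists 0.
  by exists 1.
(* With this orientation [p] is [~~ s], the port towards the predecessor of home. *)
exists a, (p == 0) => n bh A bh0; rewrite worldS ltnn andbF.
have cut0 r : r < r0 -> (0 < r) && (r0 < r) = false.
  by move=> /ltnW; rewrite leqNgt => /negbTE->; rewrite andbF.
have [eqC homeC _] := waiting_same (p == 0) home bh0 cut0.
have := seen_pos Ca; have [-> _] := eqC ord0 ord0 erefl (eqxx _) => /seen_Some Wa.
rewrite /= in Wa; have [eq_act eq_bd] := same_local alg eqC (@compatible_home _ _ true (p == 0))
  (erefl : (ord0 : 'I_3) = (ord0 : 'I_n.+3) :> nat) (eqxx _).
rewrite /= /next_agent Wa /=.
rewrite /board_before -eq_bd -(eq_act a mm en None None).
rewrite -[act_decision _]/d dE (@move_ring n (p == 0) false) /=.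
case: p p2 {dE eqC homeC Wa eq_act eq_bd} => [|[|p]] // _ /=; case: ifP => // _ [<-] /=;
  by apply: ord_inj; rewrite val_ord_pred.
Qed.

Lemma line_step n s bh (C : config 'I_n.+3 m) j a :
  agents (ring_step alg s true bh C) j = Some a ->
  exists2 b, agents C j = Some b & pos a <= (pos b).+1 /\ pos b <= (pos a).+1.
Proof.
rewrite /= /next_agent; case Cj: (agents C j) => [b|] // ab; exists b => //.
move: ab; case: (answer b) => [_ [<-]|]; first by lia.
set d := act_decision _; have := move_line s (pos b) d.
by rewrite /round_graph /=; case: (move _ _ _ (pos b) d) => w q /= near; case: ifP => // _ [<-].
Qed.

(** * Contradiction from a first departure *)

Section FirstDeparture.

Variables (r0 : nat) (a : 'I_m) (s : bool).
Hypothesis waits : forall r, r <= r0 -> at_home (waiting r).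
Let cut r := r0 < r.
Hypothesis a_leaves : forall n (bh : 'I_n.+3) A, bh != ord0 ->
  agents (world s cut bh r0.+1) a = Some A -> pos A = ord_max.

Lemma cut_before r : r < r0 -> (0 < r) && cut r = false.
Proof. by move=> /ltnW; rewrite /cut leqNgt => /negbTE->; rewrite andbF. Qed.

Lemma cut_at : (0 < r0) && cut r0 = false.
Proof. by rewrite /cut ltnn andbF. Qed.

Lemma cut_after r : r0 < r -> (0 < r) && cut r.
Proof. by rewrite /cut => lt; rewrite lt (leq_ltn_trans _ lt). Qed.

Lemma world_home n (bh : 'I_n.+3) : bh != ord0 -> at_home (world s cut bh r0).
Proof. by move=> bh0; have [] := waiting_same s waits bh0 cut_before. Qed.

(** The departure round [r0] still uses the whole ring, and all agents start it at home; the cut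
    begins one round later. *)
Lemma departure_same n n' (bh : 'I_n.+3) (bh' : 'I_n'.+3) : 1 < bh -> 1 < bh' ->
  same (fun c => c < 2) (world s cut bh r0.+1) (world s cut bh' r0.+1).
Proof.
move=> bh1 bh1'; have bh0 : bh != ord0 by apply: contraTneq bh1 => ->.
have bh0' : bh' != ord0 by apply: contraTneq bh1' => ->.
rewrite !worldS cut_at; apply: same_step; rewrite -?leqNgt //.
- by move=> c; lia.
- exact: compatible_home_nbr.
- by apply: at_home_no_arrival => //; apply: world_home.
- by apply: at_home_no_arrival => //; apply: world_home.
- by apply: waiting_same2 => //; apply: cut_before.
Qed.

Lemma a_dead n r : r0 < r -> agents (world s cut (ord_max : 'I_n.+3) r) a = None.
Proof.
move=> /world_dead; apply; case Ca: (agents _ a) => [A|] //.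
have bh0 : (ord_max : 'I_n.+3) != ord0 by [].
by have := world_bh bh0 Ca; rewrite (a_leaves bh0 Ca) eqxx.
Qed.

(** If the last node is the black hole, [a] is destroyed, so some other agent must answer; there is
    no room for a third. *)
Lemma exists_follower : exists2 b : 'I_m, b != a & forall j, j = a \/ j = b.
Proof.
have [j [r ans]] := some_answer s cut (erefl : (ord_max : 'I_5) != ord0).
have [B jB] := answers_alive r0.+1 ans.
have ja : j != a by apply/eqP => e; move: jB; rewrite e a_dead.
exists j => // i; have [->|ia] := eqVneq i a; first by left.
have [->|ij] := eqVneq i j; first by right.
have := few; have := ltn_ord i; have := ltn_ord j; have := ltn_ord a.
by move: ia ij ja; rewrite -!val_eqE /=; lia.
Qed.

Lemma no_departure : False.
Proof.
have [b ba ab] := exists_follower.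
have b_alive r : r0 < r -> exists2 B,
    agents (world s cut (ord_max : 'I_3) r) b = Some B & pos B < 2.
  move=> lt; have [j [r' ans]] := some_answer s cut (erefl : (ord_max : 'I_3) != ord0).
  have jb : j = b.
    case: (ab j) => // ja; have [A] := answers_alive r0.+1 ans.
    by rewrite ja a_dead.
  rewrite jb in ans; have [B bB] := answers_alive r ans; exists B => //.
  have nB : pos B != 2 :> nat := world_bh (erefl : (ord_max : 'I_3) != ord0) bB.
  by have := ltn_ord (pos B); lia.
(* The second conjunct is an invariant of the line: [a] starts at its far end and cannot pass the
   black hole alive. *)
have mirror (bh : 'I_5) r : 1 < bh -> r0 < r ->
    same (fun c => c < 2) (world s cut (ord_max : 'I_3) r) (world s cut bh r) /\
    forall A, agents (world s cut bh r) a = Some A -> bh < pos A.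
  move=> bh1; have bh0 : bh != ord0 by apply: contraTneq bh1 => ->.
  elim: r => // r IH; rewrite ltnS leq_eqVlt => /orP[/eqP<-|lt].
    split=> [|A aA]; first exact: departure_same.
    have ne : pos A != bh :> nat := world_bh bh0 aA.
    by rewrite (a_leaves bh0 aA) in ne *; have := ltn_ord bh; rewrite /= in ne *; lia.
  have [eqr past] := IH lt; have cutr := cut_after lt.
  rewrite [world s cut bh r.+1]worldS [X in same _ X _]worldS cutr; split; last first.
    move=> A aA; have [A' aA' [_ near]] := line_step aA.
    have aA1 : agents (world s cut bh r.+1) a = Some A by rewrite worldS cutr.
    have ne : pos A != bh :> nat := world_bh bh0 aA1.
    by have := past _ aA'; lia.
  apply: same_step (eqr); rewrite -?leqNgt //.
  - by move=> c; lia.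
  - exact: compatible_home_nbr.
  - apply: no_arrival_in => j A; case: (ab j) => ->; first by rewrite a_dead.
    by have [B -> B2] := b_alive r lt; case=> <-.
  (* In the 5-ring [b] is in {0, 1} already, like its copy in the 3-ring; [a], if alive, is at node
     3 or 4 and one move cannot bring it below 2. *)
  move=> j v v2 none; case: (ab j) none => -> none; last first.
    have [B bB B2] := b_alive r lt.
    have lt5 : pos B < 5 by lia.
    have [sn _] := eqr (pos B) (Ordinal lt5) erefl B2.
    by have := seen_pos bB; rewrite sn none.
  rewrite /seen; case aA: (agents _ a) => [A|] //.
  have [A' aA' [_ near]] := line_step aA; have := past _ aA'.
  by case: eqP => // Av; rewrite Av in near; lia.
have b_state (bh : 'I_5) r : 1 < bh -> r0 < r ->
    exists B, exists2 u : 'I_5, agents (world s cut (ord_max : 'I_3) r) b = Some B &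
      u = pos B :> nat /\ agents (world s cut bh r) b =
        Some (Agent u (Defs.mem B) (entry B) (answer B)) /\ u < 2.
  move=> bh1 lt; have [B bB B2] := b_alive r lt.
  have lt5 : pos B < 5 by lia.
  have [sn _] := (mirror bh r bh1 lt).1 (pos B) (Ordinal lt5) erefl B2.
  exists B, (Ordinal lt5) => //; split=> //; split=> //.
  by have := seen_pos bB; rewrite sn => /seen_Some.
have b_near (bh : 'I_5) r A : 1 < bh -> r0 < r ->
    agents (world s cut bh r) b = Some A -> pos A < 2.
  by move=> bh1 lt; have [B [u _ [_ [-> u2]]]] := b_state bh r bh1 lt; case=> <-.
(* Both states of [b] copy the same state in the 3-ring. *)
have eq_b (bh bh' : 'I_5) : 1 < bh -> 1 < bh' -> forall r, r0 < r ->
    agents (world s cut bh r) b = agents (world s cut bh' r) b.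
  move=> bh1 bh1' r lt; have [B [u bB [uB [-> _]]]] := b_state bh r bh1 lt.
  have [B' [u' ]] := b_state bh' r bh1' lt; rewrite bB => -[<-] [uB' [-> _]].
  by congr (Some (Agent _ _ _ _)); apply: ord_inj; rewrite uB uB'.
pose bh2 : 'I_5 := @Ordinal 5 2 isT; pose bh3 : 'I_5 := @Ordinal 5 3 isT.
have [j4 [r4 ans4]] := some_answer s cut (erefl : (ord_max : 'I_5) != ord0).
have j4b : j4 = b.
  case: (ab j4) => // j4a; have [A] := answers_alive r0.+1 ans4.
  by rewrite j4a a_dead.
rewrite {j4}j4b in ans4.
(* The answer of [b] is already used up: it is right for black hole 4. *)
have by_a (bh : 'I_5) : 1 < bh -> bh != ord_max -> exists r, answers s cut bh a r.
  move=> bh1 nbh; have bh0 : bh != ord0 by apply: contraTneq bh1 => ->.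
  have [j [r ans]] := some_answer s cut bh0; exists r.
  case: (ab j) => jE; rewrite jE // in ans.
  by case/eqP: nbh; apply: answers_uniq (eq_b bh ord_max bh1 isT) ans ans4.
have [r3 ans3] := by_a bh3 isT isT; have [r2 ans2] := by_a bh2 isT isT.
(* With black hole 3 the living agents stay here: [b] in {0, 1}, and [a] at 4, the only node past
   the black hole. *)
pose S c := (c < 2) || (c == 4).
have in_S3 r j A : r0 < r -> agents (world s cut bh3 r) j = Some A -> S (pos A).
  move=> lt jA; have lt5 := ltn_ord (pos A); case: (ab j) => jE; rewrite jE in jA.
    by have := (mirror bh3 r isT lt).2 _ jA; rewrite /S /=; lia.
  by rewrite /S (b_near bh3 r A).
have eq_a r : r0 < r -> same S (world s cut bh3 r) (world s cut bh2 r).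
  elim: r => // r IH; rewrite ltnS leq_eqVlt => /orP[/eqP<-|lt].
    rewrite !worldS cut_at; apply: same_step => //.
    - by move=> c; rewrite /S; lia.
    - exact: compatible_refl.
    - by apply: at_home_no_arrival => //; apply: world_home.
    - by apply: at_home_no_arrival => //; apply: world_home.
    - by apply: waiting_same2 => //; apply: cut_before.
  rewrite [X in same _ X _]worldS [X in same _ _ X]worldS (cut_after lt).
  apply: same_step (IH lt) => //.
  - by move=> c; rewrite /S; lia.
  - exact: compatible_refl.
  - by apply: no_arrival_in => j A; apply: in_S3.
  (* With black hole 2, [a] could also be at node 3; but with black hole 3 it is alive, since it
     answers, hence in [S], and the agreement so far puts it at the same node here. *)
  apply: no_arrival_in => j A; case: (ab j) => -> jA; last by rewrite /S (b_near bh2 r A).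
  have [A' aA'] := answers_alive r ans3; have SA' := in_S3 _ _ _ lt aA'.
  by move: jA; rewrite (same_agents (IH lt) aA' SA') => -[<-].
suff : bh3 = bh2 by [].
apply: (answers_uniq (r0 := r0.+1)) (ans3) (ans2) => r lt; have [A aA] := answers_alive r ans3.
by rewrite aA (same_agents (eq_a r lt) aA (in_S3 _ _ _ lt aA)).
Qed.

End FirstDeparture.

(** By induction, a failure at [r.+1] would be a first departure, which [no_departure] refutes. *)
Lemma always_waiting r : at_home (waiting r).
Proof.
suff : forall r', r' <= r -> at_home (waiting r') by apply.
elim: r => [|r IH] r'; first by rewrite leqn0 => /eqP->; apply/forallP => j /=.
rewrite leq_eqVlt => /orP[/eqP->|]; last exact: IH.
apply: contraT => leaves; have [a [s a_leaves]] := first_leaver IH leaves.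
by case: (no_departure IH a_leaves).
Qed.

End Worlds.

Theorem corollary1 (m : nat) (alg : algorithm) :
  solves_bhs 1 m alg -> 3 <= m.
Proof.
move=> solved; rewrite leqNgt; apply/negP => few.
exact: not_waiting_forever solved few (always_waiting solved few).
Qed.
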